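(* Let $\mathcal{H}_0, \mathcal{H}_1$ be Hilbert spaces, let $A \subseteq \mathcal{L}(\mathcal{H}_0)$ be a concrete C*-algebra, and let $\mathsf{X} \subseteq \mathcal{L}(\mathcal{H}_0, \mathcal{H}_1)$ be a closed subspace such that $xa \in \mathsf{X}$ for all $x \in \mathsf{X}$ and all $a\in A$, and such that $x^*y \in A$ for all $x,y \in \mathsf{X}$; regard $\mathsf{X}$ as a right Hilbert $A$-module with $\langle x,y\rangle_A=x^*y$. Suppose that $\mathsf{X}\mathcal{H}_0$ is dense in $\mathcal{H}_1$. Define $B \subseteq \mathcal{L}(\mathcal{H}_1)$ by $$B=\{ b \in \mathcal{L}(\mathcal{H}_1) \colon bx, b^*x \in \mathsf{X} \mbox{ for all } x \in \mathsf{X} \}.$$ For each $b \in B$ we get a map $\tau(b) \colon \mathsf{X} \to \mathsf{X}$, given by $\tau(b)(x)=bx$. Then $B$ is $*$-isomorphic to $\mathcal{L}_A(\mathsf{X})$, via the map that sends $b \in B$ to $\tau(b)$.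
   Context: $\mathcal{L}(\mathcal{H}_0,\mathcal{H}_1)$ is the space of bounded linear maps, and $\mathcal{L}(\mathcal{H})=\mathcal{L}(\mathcal{H},\mathcal{H})$. $\mathsf{X}\mathcal{H}_0=\mathrm{span}\{x\xi\colon x\in\mathsf{X},\ \xi\in\mathcal{H}_0\}\subseteq\mathcal{H}_1$. The right action of $A$ on $\mathsf{X}$ is composition of operators; with $\langle x,y\rangle_A=x^*y$, $\mathsf{X}$ is a right Hilbert $A$-module whose module norm equals the operator norm. $\mathcal{L}_A(\mathsf{X})$ denotes the C*-algebra of adjointable maps $\mathsf{X}\to\mathsf{X}$. *)

(* Defs.v *)
From HB Require Import structures.
From mathcomp Require Import all_boot all_order all_algebra.
From mathcomp Require Import complex.
From mathcomp Require Import boolp classical_sets functions reals.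
From mathcomp Require Import interval_inference topology normedtype.
From mathcomp Require Import ring lra.

Set Implicit Arguments.
Unset Strict Implicit.
Unset Printing Implicit Defensive.
Import Order.TTheory GRing.Theory Num.Def Num.Theory.
Import numFieldNormedType.Exports.
Local Open Scope classical_set_scope.
Local Open Scope ring_scope.
Local Open Scope complex_scope.

(* A complex Hilbert space: a complete normed space over R[i] whose norm comes
   from an inner product. As for every {dot _ for conjC} in MathComp, the inner
   product is linear in its first argument and antilinear in its second. *)
HB.mixin Record CompleteNormedModule_isHilbert (R : realType) V
    of CompleteNormedModule R[i] V := {
  hdot : {dot V for @conjC R[i]};
  hnormE : forall x : V, `|x| ^+ 2 = hdot x x
}.

#[short(type="hilbertType")]
HB.structure Definition Hilbert (R : realType) :=
  {V of CompleteNormedModule_isHilbert R V & CompleteNormedModule R[i] V}.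

Definition bounded_linear (R : realType) (H K : hilbertType R) : {pred H -> K} :=
  fun T => `[< linear T /\
               exists M : R, forall x : H, `|T x| <= M%:C * `|x| >].

Section BoundedLinear.
Context {R : realType} {H K : hilbertType R}.

Lemma bounded_linear_submod : submod_closed (@bounded_linear R H K).
Proof.
have E0 x : (0 : H -> K) x = 0 by [].
have ED (a : R[i]) (S T : H -> K) x : (a *: S + T) x = a *: S x + T x by [].
split.
  apply/asboolP; split; first by move=> a x y; rewrite !E0 scaler0 addr0.
  by exists 0 => x; rewrite E0 normr0 mul0r.
move=> a S T /asboolP[linS [M SM]] /asboolP[linT [N TN]]; apply/asboolP; split.
  move=> c x y; rewrite !ED linS linT !scalerDr !scalerA (mulrC a c).
  by rewrite !addrA; congr (_ + _); rewrite -!addrA; congr (_ + _); rewrite addrC.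
have aE : (complex.Re `|a|)%:C = `|a| by rewrite RRe_real ?normr_real.
exists (complex.Re `|a| * M + N) => x.
have -> : (complex.Re `|a| * M + N)%:C = `|a| * M%:C + N%:C :> R[i].
  by rewrite -[in RHS]aE -rmorphM -rmorphD.
rewrite mulrDl ED (le_trans (ler_normD _ _))// lerD//.
by rewrite normrZ -mulrA ler_wpM2l.
Qed.

HB.instance Definition _ :=
  GRing.isSubmodClosed.Build R[i] (H -> K) (@bounded_linear R H K)
    bounded_linear_submod.

End BoundedLinear.

Record bop (R : realType) (H K : hilbertType R) := Bop {
  bop_fun :> H -> K;
  bop_subproof : bop_fun \in @bounded_linear R H K
}.

HB.instance Definition _ (R : realType) (H K : hilbertType R) :=
  [isSub for @bop_fun R H K].
HB.instance Definition _ (R : realType) (H K : hilbertType R) :=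
  [Choice of bop H K by <:].
HB.instance Definition _ (R : realType) (H K : hilbertType R) :=
  [SubChoice_isSubLmodule of bop H K by <:].

Section BoundedOperator.
Context {R : realType} {H K : hilbertType R}.
Implicit Types (S T : bop H K) (x y : H).

Lemma bopP S T : S =1 T -> S = T.
Proof. by move=> ST; apply/val_inj/funext. Qed.

Lemma bop_linear T : linear T.
Proof. by case: T => T /= /asboolP[]. Qed.

HB.instance Definition _ T := GRing.isLinear.Build R[i] H K _ T (bop_linear T).

Lemma bop_bounded T : exists M : R, forall x, `|T x| <= M%:C * `|x|.
Proof. by case: T => T /= /asboolP[]. Qed.

Lemma bop0E x : (0 : bop H K) x = 0. Proof. by []. Qed.
Lemma bopDE S T x : (S + T) x = S x + T x. Proof. by []. Qed.
Lemma bopZE (c : R[i]) T x : (c *: T) x = c *: T x. Proof. by []. Qed.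

(* The norm of bop H K, and thus its topology, is the operator norm; as for
   every normed space over R[i], it is a nonnegative real element of R[i]. *)
Definition opnorm T : R[i] :=
  (sup [set complex.Re `|T x| | x in [set x : H | `|x| <= 1]])%:C.

Let normRe (V : normedModType R[i]) (v : V) : (complex.Re `|v|)%:C = `|v|.
Proof. by rewrite RRe_real ?normr_real. Qed.

Let opset T := [set complex.Re `|T x| | x in [set x : H | `|x| <= 1]].

Let opset0 T : opset T 0.
Proof. by exists 0; rewrite /= ?normr0 ?ler01// linear0 normr0. Qed.

Let opset_ubound T : has_ubound (opset T).
Proof.
have [M TM] := bop_bounded T; exists `|M| => _ [x /= x1 <-].
rewrite -lecR normRe (le_trans (TM x))//.
rewrite (@le_trans _ _ (`|M|%:C * `|x|)) ?ler_wpM2r ?lecR ?ler_norm//.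
by rewrite -[leRHS]mulr1 ler_wpM2l// ler0c.
Qed.

Lemma opnorm_ge0 T : 0 <= opnorm T.
Proof. by rewrite ler0c; exact: (ub_le_sup (opset_ubound T)) (opset0 T). Qed.

Lemma opnorm_ub T x : `|T x| <= opnorm T * `|x|.
Proof.
have [->|x0] := eqVneq x 0; first by rewrite linear0 !normr0 mulr0.
have nx : 0 < `|x| by rewrite normr_gt0.
suff : `|T (`|x|^-1 *: x)| <= opnorm T.
  by rewrite linearZ/= normrZ ger0_norm ?invr_ge0// ler_pdivrMl// [leRHS]mulrC.
rewrite -normRe lecR; apply: (ub_le_sup (opset_ubound T)).
exists (`|x|^-1 *: x) => //=.
by rewrite normrZ ger0_norm ?invr_ge0// mulVf// gt_eqF.
Qed.

Lemma opnorm_le T (M : R[i]) : 0 <= M ->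
  (forall x, `|T x| <= M * `|x|) -> opnorm T <= M.
Proof.
move=> M0 TM; rewrite -(RRe_real (ger0_real M0)) lecR.
apply: ge_sup; first by exists 0; exact: opset0.
move=> _ [x /= x1 <-]; rewrite -lecR normRe RRe_real ?ger0_real//.
by rewrite (le_trans (TM x))// -[leRHS]mulr1 ler_wpM2l.
Qed.

Lemma opnormD S T : opnorm (S + T) <= opnorm S + opnorm T.
Proof.
apply: opnorm_le => [|x]; first by rewrite addr_ge0 ?opnorm_ge0.
by rewrite mulrDl bopDE (le_trans (ler_normD _ _))// lerD ?opnorm_ub.
Qed.

Lemma opnormZ (c : R[i]) T : opnorm (c *: T) = `|c| * opnorm T.
Proof.
have le d S : opnorm (d *: S) <= `|d| * opnorm S.
  apply: opnorm_le => [|x]; first by rewrite mulr_ge0 ?opnorm_ge0.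
  by rewrite bopZE normrZ -mulrA ler_wpM2l ?opnorm_ub.
apply/eqP; rewrite eq_le le/=.
have [->|c0] := eqVneq c 0; first by rewrite normr0 mul0r opnorm_ge0.
by rewrite mulrC -ler_pdivlMr ?normr_gt0// mulrC -normfV -{1}(scalerK c0 T) le.
Qed.

Lemma opnorm0_eq0 T : opnorm T = 0 -> T = 0.
Proof.
move=> T0; apply: bopP => x; apply/eqP; rewrite bop0E -normr_le0.
by rewrite (le_trans (opnorm_ub T x))// T0 mul0r.
Qed.

HB.instance Definition _ :=
  Lmodule_isNormed.Build R[i] (bop H K) opnormD opnormZ opnorm0_eq0.

End BoundedOperator.
Section Riesz.
Context {R : realType} {H : hilbertType R}.
Implicit Types x y z : H.
Local Notation C := R[i].

Lemma hdotC x y : hdot x y = conjC (hdot y x).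
Proof. by rewrite (@hermitian_subproof _ _ false conjC hdot x y) expr0 mul1r. Qed.

Lemma hdotZr a x y : hdot x (a *: y) = conjC a * hdot x y.
Proof. by rewrite linearZr_LR. Qed.

Lemma hdotZl a x y : hdot (a *: x) y = a * hdot x y.
Proof. by rewrite linearZl_LR. Qed.

Lemma hdotDl x y z : hdot (x + y) z = hdot x z + hdot y z.
Proof. by rewrite linearDl. Qed.

Lemma hdotDr x y z : hdot x (y + z) = hdot x y + hdot x z.
Proof. by rewrite linearDr. Qed.

Lemma hdot_proj x y : y != 0 ->
  let d := hdot x y in let w := x - (d / hdot y y) *: y in
  hdot w w = hdot x x - `|d| ^+ 2 / hdot y y.
Proof.
move=> y0; have sgt0 : 0 < hdot y y by rewrite dnorm_gt0.
have sJ : conjC (hdot y y) = hdot y y by rewrite -hdotC.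
have s0 : hdot y y != 0 by rewrite gt_eqF.
have dJ : conjC (hdot x y / hdot y y) = conjC (hdot x y) / hdot y y.
  by rewrite rmorphM /= fmorphV /= sJ.
have ndJ : conjC (`|hdot x y| ^+ 2 / hdot y y) = `|hdot x y| ^+ 2 / hdot y y.
  by rewrite conj_Creal// ger0_real// divr_ge0 ?exprn_ge0 ?(ltW sgt0).
move=> d w; rewrite {}/w {}/d (dnormB hdot) (dnormZ hdot) hdotZr dJ.
have -> : conjC (hdot x y) / hdot y y * hdot x y = `|hdot x y| ^+ 2 / hdot y y.
  by rewrite normCK mulrAC [conjC _ * _]mulrC.
rewrite ndJ.
rewrite normrM normfV exprMn exprVn (ger0_norm (ltW sgt0)).
by field.
Qed.

Lemma hdot_CauchySchwarz x y : `|hdot x y| <= `|x| * `|y|.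
Proof.
have [->|y0] := eqVneq y 0; first by rewrite linear0r !normr0 mulr0.
rewrite -(@ler_pXn2r _ 2)// ?nnegrE ?mulr_ge0// exprMn !hnormE.
rewrite -ler_pdivrMr ?dnorm_gt0// -subr_ge0 -hdot_proj// dnorm_ge0.
Qed.

Lemma hdot_inj y z : (forall x, hdot x y = hdot x z) -> y = z.
Proof.
move=> yz; apply/eqP; rewrite -subr_eq0 -(dnorm_eq0 hdot).
by rewrite linearBr/= yz subrr.
Qed.

Let q x : R := complex.Re (hdot x x).

Let qE x : (q x)%:C = hdot x x.
Proof. by rewrite RRe_real// ger0_real// dnorm_ge0. Qed.

Let q_ge0 x : 0 <= q x. Proof. by rewrite -ler0c qE dnorm_ge0. Qed.

Let q_parallelogram x y : q (x - y) = 2 * q x + 2 * q y - 4 * q (2^-1 *: (x + y)).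
Proof.
have E : hdot (x - y) (x - y) = 2%:R * hdot x x + 2%:R * hdot y y -
    4%:R * hdot (2^-1 *: (x + y)) (2^-1 *: (x + y)).
  rewrite (dnormZ hdot) (dnormB hdot) (dnormD hdot) normfV normr_nat.
  by field.
apply: complexI; rewrite qE E -!qE !(rmorphB, rmorphD, rmorphM).
by rewrite !rmorph1.
Qed.

Lemma Riesz_representation (f : H -> C) : linear_for *%R f ->
  (exists M : R, forall x, `|f x| <= M%:C * `|x|) ->
  exists y, forall x, f x = hdot x y.
Proof.
move=> linf [M fM].
have f0 : f 0 = 0.
  by have := linf (-1) 0 0; rewrite scaler0 addr0 mulN1r addNr.
have fD x y : f (x + y) = f x + f y by rewrite -[x in LHS]scale1r linf mul1r.
have fZ a x : f (a *: x) = a * f x by rewrite -[a *: x]addr0 linf f0 addr0.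
have fB x y : f (x - y) = f x - f y by rewrite fD -scaleN1r fZ mulN1r.
have [/existsNP[x0 /eqP fx0]|/contrapT f_0] := pselect (~ forall x, f x = 0); last first.
  by exists 0 => x; rewrite linear0r f_0.
pose K := [set x | f x = 1].
have Kx0 : K ((f x0)^-1 *: x0) by rewrite /K /= fZ mulVf.
pose D := inf (q @` K).
have lbK : has_lbound (q @` K) by exists 0 => _ [x _ <-].
have Dle x : K x -> D <= q x.
  by move=> Kx; apply: ge_inf => //; exists x.
have /choice[u uP] n : exists x, K x /\ q x < D + n.+1%:R^-1.
  have n0 : 0 < n.+1%:R^-1 :> R by rewrite invr_gt0.
  have infK : has_inf (q @` K).
    by split => //; exists (q ((f x0)^-1 *: x0)), ((f x0)^-1 *: x0).
  by have [_ [x Kx <-] xlt] := inf_adherent n0 infK; exists x.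
have small (e : R) : 0 < e -> exists N, forall n, (N <= n)%N -> n.+1%:R^-1 < e.
  move=> e0; have [N _ NP] := near_infty_natSinv_lt (PosNum e0).
  by exists N.
have ucauchy : cauchy (u @ \oo).
  apply: cauchy_exP => eps eps0.
  have epsE : (complex.Re eps)%:C = eps by rewrite RRe_real// gtr0_real.
  have e0 : 0 < complex.Re eps by rewrite -ltcR epsE.
  have [|N NP] := small (complex.Re eps ^+ 2 / 4); first by rewrite divr_gt0// exprn_gt0.
  exists (u N), N => // n /= Nn; rewrite -ball_normE /=.
  rewrite -(@ltr_pXn2r _ 2)// ?nnegrE// ?(ltW eps0)// hnormE -qE -epsE -rmorphXn/= ltcR.
  have [KN qN] := uP N; have [Kn qn] := uP n.
  have Kmid : K (2^-1 *: (u N + u n)).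
    by rewrite /K/= fZ fD KN Kn -[1 + 1]/(2%:R) mulVf// pnatr_eq0.
  have := NP _ (leqnn N); have := NP _ Nn; have := Dle _ Kmid.
  rewrite q_parallelogram; move: qN qn.
  move: (N.+1%:R^-1) (n.+1%:R^-1) (complex.Re eps ^+ 2) (q (_ *: _)) => a b c m.
  move: (q (u N)) (q (u n)) => qN qn.
  lra.
have [z uz] : exists z, u @ \oo --> z by apply/cvg_ex; exact: cauchy_cvg.
have Kz : K z.
  apply/eqP; rewrite -subr_eq0; apply/negPn/negP => fz1.
  have M0 : 0 < (`|M| + 1)%:C :> C by rewrite ltcR ltr_wpDl.
  have e0 : 0 < `|f z - 1| / (`|M| + 1)%:C by rewrite divr_gt0 ?normr_gt0.
  have /cvgrPdist_lt/(_ _ e0)[N _ /(_ N (leqnn N))/=] := uz.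
  rewrite (ltr_pdivlMr _ _ M0) => lt; suff: `|f z - 1| < `|f z - 1| by rewrite ltxx.
  apply: le_lt_trans lt.
  have [KN _] := uP N; rewrite -KN -fB (le_trans (fM _))// mulrC ler_wpM2l// lecR.
  by rewrite (le_trans (ler_norm _))// lerDl.
have qz : q z <= D.
  rewrite leNgt; apply/negP => Dz.
  have e0 : 0 < (q z - D) / 2 by rewrite divr_gt0// subr_gt0.
  have e0C : 0 < ((q z - D) / 2)%:C by rewrite ltcR.
  have [N1 N1P] := small _ e0.
  have : `|u n| ^+ 2 @[n --> \oo] --> `|z| ^+ 2.
    by apply: cvgM; exact: cvg_norm.
  move=> /cvgrPdist_lt/(_ _ e0C)[N2 _ N2P].
  have := N1P _ (leq_maxl N1 N2); have := N2P _ (leq_maxr N1 N2) => /=.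
  have [_] := uP (maxn N1 N2).
  rewrite !hnormE -!qE -rmorphB normc_def /= expr0n addr0 sqrtr_sqr ltcR.
  move: (_^-1 : R) (q (u _)) Dz => a b Dz.
  rewrite ltr_norml; lra.
have orth v : f v = 0 -> hdot v z = 0.
  move=> fv; have [->|v0] := eqVneq v 0; first by rewrite linear0l.
  have Kw : K (z - (hdot z v / hdot v v) *: v).
    by rewrite /K/= fB fZ fv mulr0 subr0.
  have := le_trans qz (Dle _ Kw); rewrite -lecR !qE hdot_proj//.
  rewrite lerBrDl -lerBrDr subrr pmulr_lle0 ?invr_gt0 ?dnorm_gt0//.
  move=> zv_le0; have : `|hdot z v| ^+ 2 == 0 by rewrite eq_le zv_le0 exprn_ge0.
  rewrite expf_eq0 /= normr_eq0 => /eqP zv.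
  by rewrite hdotC zv conjC0.
have z0 : z != 0 by apply: contra_eq_neq Kz => ->; rewrite f0 eq_sym oner_neq0.
have zz0 : hdot z z != 0 by rewrite dnorm_eq0.
exists ((hdot z z)^-1 *: z) => x.
have := orth (x - f x *: z); rewrite fB fZ Kz mulr1 subrr => /(_ erefl)/eqP.
rewrite linearBl/= linearZl_LR/= subr_eq0 => /eqP xz.
have zzJ : conjC (hdot z z) = hdot z z by rewrite -hdotC.
by rewrite hdotZr xz fmorphV /= zzJ mulrC mulfK.
Qed.

End Riesz.

Section Adjoint.
Context {R : realType} {H K : hilbertType R}.

Lemma adjoint_exists (T : bop H K) :
  exists S : bop K H, forall x y, hdot (T x) y = hdot x (S y).
Proof.
have /choice[S SP] y : exists z, forall x, hdot (T x) y = hdot x z.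
  apply: Riesz_representation => [c x1 x2|].
    by rewrite linearP linearPl.
  exists (complex.Re (`|T| * `|y|)) => x.
  rewrite RRe_real ?ger0_real ?mulr_ge0// mulrAC.
  by rewrite (le_trans (hdot_CauchySchwarz _ _))// ler_wpM2r// opnorm_ub.
have linS : linear S.
  move=> c y1 y2; apply: hdot_inj => x.
  by rewrite -SP [in RHS]linearPr/= [in LHS]linearPr/= !SP.
suff Sb : S \in @bounded_linear R K H by exists (Bop Sb).
apply/asboolP; split => //; exists (complex.Re `|T|) => y.
rewrite RRe_real ?normr_real//.
have [->|Sy0] := eqVneq (S y) 0; first by rewrite normr0 mulr_ge0.
rewrite -(ler_pM2l (x := `|S y|)) ?normr_gt0// -expr2 hnormE.
have <- : `|hdot (T (S y)) y| = hdot (S y) (S y) by rewrite SP ger0_norm// dnorm_ge0.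
by rewrite (le_trans (hdot_CauchySchwarz _ _))// mulrA ler_wpM2r// mulrC opnorm_ub.
Qed.
End Adjoint.

Section AdjointComposition.
Context {R : realType}.
Implicit Types H K L : hilbertType R.

Definition adj H K (T : bop H K) : bop K H := projT1 (cid (adjoint_exists T)).

Lemma adjP H K (T : bop H K) x y : hdot (T x) y = hdot x (adj T y).
Proof. by rewrite /adj; case: cid => S /= ->. Qed.

Lemma adj_uniq H K (T : bop H K) (S : bop K H) :
  (forall x y, hdot (T x) y = hdot x (S y)) -> adj T = S.
Proof.
by move=> TS; apply: bopP => y; apply: hdot_inj => x; rewrite -adjP TS.
Qed.

Lemma adjK H K (T : bop H K) : adj (adj T) = T.
Proof. by apply: adj_uniq => x y; rewrite hdotC -adjP -hdotC. Qed.

Lemma adjD H K (S T : bop H K) : adj (S + T) = adj S + adj T.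
Proof.
by apply: adj_uniq => x y; rewrite !bopDE hdotDl !adjP hdotDr.
Qed.

Lemma adjZ H K (c : R[i]) (T : bop H K) : adj (c *: T) = conjC c *: adj T.
Proof.
by apply: adj_uniq => x y; rewrite !bopZE hdotZl hdotZr conjCK adjP.
Qed.

Lemma bcomp_subproof H K L (S : bop K L) (T : bop H K) :
  (S \o T) \in @bounded_linear R H L.
Proof.
apply/asboolP; split; first by move=> c x y /=; rewrite !linearP.
exists (complex.Re (`|S| * `|T|)) => x.
rewrite RRe_real ?ger0_real ?mulr_ge0// -mulrA /=.
by rewrite (le_trans (opnorm_ub S _))// ler_wpM2l ?opnorm_ge0//; exact: opnorm_ub.
Qed.

Definition bcomp H K L (S : bop K L) (T : bop H K) : bop H L :=
  Bop (bcomp_subproof S T).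

Lemma bcompA H0 H K L (S : bop K L) (T : bop H K) (U : bop H0 H) :
  bcomp S (bcomp T U) = bcomp (bcomp S T) U.
Proof. exact: bopP. Qed.

Lemma bcompDl H K L (S S' : bop K L) (T : bop H K) :
  bcomp (S + S') T = bcomp S T + bcomp S' T.
Proof. exact: bopP. Qed.

Lemma bcompDr H K L (S : bop K L) (T T' : bop H K) :
  bcomp S (T + T') = bcomp S T + bcomp S T'.
Proof. by apply: bopP => x; exact: (linearD S). Qed.

Lemma bcompZl H K L (c : R[i]) (S : bop K L) (T : bop H K) :
  bcomp (c *: S) T = c *: bcomp S T.
Proof. exact: bopP. Qed.

Lemma bcompZr H K L (c : R[i]) (S : bop K L) (T : bop H K) :
  bcomp S (c *: T) = c *: bcomp S T.
Proof. by apply: bopP => x; exact: (linearZZ S c (T x)). Qed.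

Lemma bcomp0r H K L (S : bop K L) : bcomp S (0 : bop H K) = 0.
Proof. by apply: bopP => x; exact: (linear0 S). Qed.

Lemma bcomp0l H K L (T : bop H K) : bcomp (0 : bop K L) T = 0.
Proof. exact: bopP. Qed.

Lemma adjM H K L (S : bop K L) (T : bop H K) :
  adj (bcomp S T) = bcomp (adj T) (adj S).
Proof. by apply: adj_uniq => x y /=; rewrite !adjP. Qed.

Lemma adj_comp_eq0 H K (T : bop H K) : bcomp (adj T) T = 0 -> T = 0.
Proof.
move=> TT0; apply: bopP => x; apply/eqP; rewrite bop0E -(dnorm_eq0 hdot) adjP.
by rewrite -[adj T (T x)]/(bcomp (adj T) T x) TT0 bop0E linear0r.
Qed.

End AdjointComposition.

(* Complex *-algebras, not necessarily unital. *)
HB.mixin Record Lmodule_isStarAlgebra (R : realType) V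
    of GRing.Lmodule R[i] V := {
  amul : V -> V -> V;
  astar : V -> V;
  amulA : associative amul;
  amulDl : left_distributive amul +%R;
  amulDr : right_distributive amul +%R;
  amulZl : forall (c : R[i]) a b, amul (c *: a) b = c *: amul a b;
  amulZr : forall (c : R[i]) a b, amul a (c *: b) = c *: amul a b;
  astarD : {morph astar : a b / a + b};
  astarZ : forall (c : R[i]) a, astar (c *: a) = conjC c *: astar a;
  astarM : forall a b, astar (amul a b) = amul (astar b) (astar a);
  astarK : involutive astar
}.

#[short(type="starAlgType")]
HB.structure Definition StarAlgebra (R : realType) :=
  {V of Lmodule_isStarAlgebra R V & GRing.Lmodule R[i] V}.

HB.instance Definition _ (R : realType) (H : hilbertType R) :=
  Lmodule_isStarAlgebra.Build R (bop H H) (@bcompA R H H H H)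
    (fun a b c => bcompDl a b c) (fun a b c => bcompDr a b c)
    (@bcompZl R H H H) (@bcompZr R H H H)
    (@adjD R H H) (@adjZ R H H) (@adjM R H H H) (@adjK R H H).

Definition star_isomorphism (R : realType) (V W : starAlgType R) (f : V -> W) :=
  [/\ bijective f, linear f,
      forall a b, f (amul a b) = amul (f a) (f b) &
      forall a, f (astar a) = astar (f a)].

Record starSubalg (R : realType) (V : starAlgType R) := StarSubalg {
  starsub_set :> set V;
  starsub_submod : submod_closed [in starsub_set];
  starsubM : forall a b, starsub_set a -> starsub_set b -> starsub_set (amul a b);
  starsubJ : forall a, starsub_set a -> starsub_set (astar a)
}.

Section StarSubalgebra.
Context {R : realType} {V : starAlgType R} (A : starSubalg V).

Definition starsub_pred : {pred V} := [in (A : set V)].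

HB.instance Definition _ :=
  GRing.isSubmodClosed.Build R[i] V starsub_pred (starsub_submod A).

Record starsub_elt := StarsubElt {
  starsub_val :> V;
  starsub_subproof : starsub_val \in starsub_pred
}.

HB.instance Definition _ := [isSub for starsub_val].
HB.instance Definition _ := [Choice of starsub_elt by <:].
HB.instance Definition _ := [SubChoice_isSubLmodule of starsub_elt by <:].

Lemma starsub_in (a : starsub_elt) : (A : set V) a.
Proof. by case: a => a /= /set_mem. Qed.

Definition starsub_elt_of a (Aa : (A : set V) a) := @StarsubElt a (mem_set Aa).

Let mul (a b : starsub_elt) :=
  starsub_elt_of (starsubM (starsub_in a) (starsub_in b)).
Let star (a : starsub_elt) := starsub_elt_of (starsubJ (starsub_in a)).

Let mulA : associative mul.
Proof. by move=> a b c; apply: val_inj; exact: amulA. Qed.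
Let mulDl : left_distributive mul +%R.
Proof. by move=> a b c; apply: val_inj; exact: amulDl. Qed.
Let mulDr : right_distributive mul +%R.
Proof. by move=> a b c; apply: val_inj; exact: amulDr. Qed.
Let mulZl (c : R[i]) a b : mul (c *: a) b = c *: mul a b.
Proof. by apply: val_inj; exact: amulZl. Qed.
Let mulZr (c : R[i]) a b : mul a (c *: b) = c *: mul a b.
Proof. by apply: val_inj; exact: amulZr. Qed.
Let starD : {morph star : a b / a + b}.
Proof. by move=> a b; apply: val_inj; exact: astarD. Qed.
Let starZ (c : R[i]) a : star (c *: a) = conjC c *: star a.
Proof. by apply: val_inj; exact: astarZ. Qed.
Let starM a b : star (mul a b) = mul (star b) (star a).
Proof. by apply: val_inj; exact: astarM. Qed.
Let starK : involutive star.
Proof. by move=> a; apply: val_inj; exact: astarK. Qed.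

HB.instance Definition _ := Lmodule_isStarAlgebra.Build R starsub_elt
  mulA mulDl mulDr mulZl mulZr starD starZ starM starK.

End StarSubalgebra.

(* Concrete C*-algebras: operator-norm closed *-subalgebras of L(H). They need
   neither be unital nor act nondegenerately. *)
Record concrete_cstar (R : realType) (H : hilbertType R) := ConcreteCstar {
  cstar_alg :> starSubalg (bop H H);
  cstar_closed : closed (cstar_alg : set (bop H H))
}.

(* Closed subspaces X of L(H0, H1) with X A `<=` X and X^* X `<=` A. The norm
   of the right Hilbert A-module X is the operator norm, so that closedness
   amounts to completeness. *)
Record hilbert_module (R : realType) (H0 H1 : hilbertType R)
    (A : concrete_cstar H0) := HilbertModule {
  cmod_set :> set (bop H0 H1);
  cmod_submod : submod_closed [in cmod_set];
  cmod_closed : closed cmod_set;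
  cmod_act : forall x a,
    cmod_set x -> (A : set (bop H0 H0)) a -> cmod_set (bcomp x a);
  cmod_dot_in : forall x y,
    cmod_set x -> cmod_set y -> (A : set (bop H0 H0)) (bcomp (adj x) y)
}.
Arguments hilbert_module {R H0} H1 A.

Section HilbertModule.
Context {R : realType} {H0 H1 : hilbertType R} {A : concrete_cstar H0}.
Context (X : hilbert_module H1 A).
Local Notation Xset := (X : set (bop H0 H1)).

Definition cmod_pred : {pred bop H0 H1} := [in Xset].

HB.instance Definition _ :=
  GRing.isSubmodClosed.Build R[i] (bop H0 H1) cmod_pred (cmod_submod X).

Record cmod_elt := CmodElt {
  cmod_val :> bop H0 H1;
  cmod_subproof : cmod_val \in cmod_pred
}.

HB.instance Definition _ := [isSub for cmod_val].
HB.instance Definition _ := [Choice of cmod_elt by <:].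
HB.instance Definition _ := [SubChoice_isSubLmodule of cmod_elt by <:].

Lemma cmod_in (x : cmod_elt) : Xset x.
Proof. by case: x => x /= /set_mem. Qed.

Definition cmod_elt_of x (Xx : Xset x) : cmod_elt := @CmodElt x (mem_set Xx).

(* The A-valued inner product <x, y>_A = x^* y. *)
Definition cmod_dot (x y : cmod_elt) : starsub_elt A :=
  starsub_elt_of (cmod_dot_in (cmod_in x) (cmod_in y)).

Lemma cmod_dotC x y : astar (cmod_dot x y) = cmod_dot y x.
Proof. by apply: val_inj; rewrite /= /astar/= adjM adjK. Qed.

Lemma cmod_dotDr x y z : cmod_dot x (y + z) = cmod_dot x y + cmod_dot x z.
Proof. by apply: val_inj; exact: bcompDr. Qed.

Lemma cmod_dotZr (c : R[i]) x y : cmod_dot x (c *: y) = c *: cmod_dot x y.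
Proof. by apply: val_inj; exact: bcompZr. Qed.

Lemma cmod_dotDl x y z : cmod_dot (x + y) z = cmod_dot x z + cmod_dot y z.
Proof. by rewrite -cmod_dotC cmod_dotDr astarD !cmod_dotC. Qed.

Lemma cmod_dotZl (c : R[i]) x y : cmod_dot (c *: x) y = conjC c *: cmod_dot x y.
Proof. by rewrite -cmod_dotC cmod_dotZr astarZ !cmod_dotC. Qed.

Lemma cmod_dot_injr y z : (forall x, cmod_dot x y = cmod_dot x z) -> y = z.
Proof.
move=> yz; apply/eqP; rewrite -subr_eq0; apply/eqP/val_inj.
apply: adj_comp_eq0; rewrite -[LHS]/(val (cmod_dot (y - z) (y - z))).
by rewrite cmod_dotDr yz -cmod_dotDr subrr -(scale0r 0) cmod_dotZr scale0r.
Qed.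

Lemma cmod_dot_injl y z : (forall x, cmod_dot y x = cmod_dot z x) -> y = z.
Proof.
by move=> yz; apply: cmod_dot_injr => x; rewrite -cmod_dotC yz cmod_dotC.
Qed.

(* Adjointable maps are arbitrary functions with an adjoint for <_, _>_A:
   linearity, A-linearity and boundedness are consequences. *)
Definition adjointable : {pred cmod_elt -> cmod_elt} :=
  fun t => `[< exists s : cmod_elt -> cmod_elt,
                 forall x y, cmod_dot (t x) y = cmod_dot x (s y) >].

Lemma adjointable_submod : submod_closed adjointable.
Proof.
have E0 x : (0 : cmod_elt -> cmod_elt) x = 0 by [].
have ED (c : R[i]) (s t : cmod_elt -> cmod_elt) x :
  (c *: s + t) x = c *: s x + t x by [].
split.
  apply/asboolP; exists 0 => x y; rewrite !E0 -[0 in LHS](scale0r x).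
  by rewrite cmod_dotZl conjC0 -[in RHS](scale0r y) cmod_dotZr !scale0r.
move=> c t1 t2 /asboolP[s1 s1P] /asboolP[s2 s2P]; apply/asboolP.
exists (conjC c *: s1 + s2) => x y.
by rewrite !ED cmod_dotDl cmod_dotZl cmod_dotDr cmod_dotZr s1P s2P.
Qed.

HB.instance Definition _ :=
  GRing.isSubmodClosed.Build R[i] (cmod_elt -> cmod_elt) adjointable
    adjointable_submod.

Record adjointable_op := AdjointableOp {
  adjop_fun :> cmod_elt -> cmod_elt;
  adjop_subproof : adjop_fun \in adjointable
}.

HB.instance Definition _ := [isSub for adjop_fun].
HB.instance Definition _ := [Choice of adjointable_op by <:].
HB.instance Definition _ := [SubChoice_isSubLmodule of adjointable_op by <:].

Lemma adjopP (s t : adjointable_op) : s =1 t -> s = t.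
Proof. by move=> st; apply/val_inj/funext. Qed.

Lemma adjop_exists (t : adjointable_op) :
  exists s : adjointable_op, forall x y, cmod_dot (t x) y = cmod_dot x (s y).
Proof.
have /asboolP[s sP] := adjop_subproof t.
suff sA : s \in adjointable by exists (AdjointableOp sA).
apply/asboolP; exists t => x y.
by rewrite -cmod_dotC -sP cmod_dotC.
Qed.

Definition adjop_adj (t : adjointable_op) : adjointable_op :=
  projT1 (cid (adjop_exists t)).

Lemma adjop_adjP (t : adjointable_op) x y : cmod_dot (t x) y = cmod_dot x (adjop_adj t y).
Proof. by rewrite /adjop_adj; case: cid => s /= ->. Qed.

Lemma adjop_uniq (t s : adjointable_op) :
  (forall x y, cmod_dot (t x) y = cmod_dot x (s y)) -> adjop_adj t = s.
Proof.
by move=> ts; apply: adjopP => y; apply: cmod_dot_injr => x; rewrite -adjop_adjP ts.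
Qed.

Lemma adjop_linear (t : adjointable_op) : linear t.
Proof.
move=> c x y; apply: cmod_dot_injl => z.
by rewrite cmod_dotDl cmod_dotZl !adjop_adjP cmod_dotDl cmod_dotZl.
Qed.

Lemma adjop_comp_subproof (s t : adjointable_op) : (s \o t) \in adjointable.
Proof.
apply/asboolP; exists (adjop_adj t \o adjop_adj s) => x y /=.
by rewrite !adjop_adjP.
Qed.

Definition adjop_comp (s t : adjointable_op) : adjointable_op :=
  AdjointableOp (adjop_comp_subproof s t).

Lemma adjopDE (s t : adjointable_op) x : (s + t) x = s x + t x.
Proof. by []. Qed.

Lemma adjopZE (c : R[i]) (t : adjointable_op) x : (c *: t) x = c *: t x.
Proof. by []. Qed.

Let compA : associative adjop_comp. Proof. by move=> s t u; exact: adjopP. Qed.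
Let compDl : left_distributive adjop_comp +%R.
Proof. by move=> s t u; exact: adjopP. Qed.
Let compDr : right_distributive adjop_comp +%R.
Proof.
move=> s t u; apply: adjopP => x.
have := adjop_linear s 1 (t x) (u x); rewrite !scale1r; exact.
Qed.
Let compZl (c : R[i]) s t : adjop_comp (c *: s) t = c *: adjop_comp s t.
Proof. exact: adjopP. Qed.
Let compZr (c : R[i]) s t : adjop_comp s (c *: t) = c *: adjop_comp s t.
Proof.
have s0 : s 0 = 0.
  by have := adjop_linear s (-1) 0 0; rewrite scaler0 addr0 scaleN1r addNr.
apply: adjopP => x.
have := adjop_linear s c (t x) 0; rewrite s0 !addr0; exact.
Qed.
Let oadjD : {morph adjop_adj : s t / s + t}.
Proof.
move=> s t; apply: adjop_uniq => x y.
by rewrite !adjopDE cmod_dotDl cmod_dotDr !adjop_adjP.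
Qed.
Let oadjZ (c : R[i]) s : adjop_adj (c *: s) = conjC c *: adjop_adj s.
Proof.
apply: adjop_uniq => x y.
by rewrite !adjopZE cmod_dotZl cmod_dotZr adjop_adjP.
Qed.
Let oadjM (s t : adjointable_op) : adjop_adj (adjop_comp s t) = adjop_comp (adjop_adj t) (adjop_adj s).
Proof. by apply: adjop_uniq => x y /=; rewrite !adjop_adjP. Qed.
Let oadjK : involutive adjop_adj.
Proof.
by move=> t; apply: adjop_uniq => x y; rewrite -cmod_dotC -adjop_adjP cmod_dotC.
Qed.

HB.instance Definition _ := Lmodule_isStarAlgebra.Build R adjointable_op
  compA compDl compDr compZl compZr oadjD oadjZ oadjM oadjK.

(* B = {b in L(H1) : b x and b^* x lie in X for all x in X}; multiplier_alg is
   B with the *-algebra structure induced by L(H1). *)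
Definition multiplier_set : set (bop H1 H1) :=
  [set b | forall x, Xset x -> Xset (bcomp b x) /\ Xset (bcomp (adj b) x)].

Let XlinP (c : R[i]) x y : Xset x -> Xset y -> Xset (c *: x + y).
Proof.
move=> Xx Xy; apply/set_mem; have [_] := cmod_submod X; apply; exact: mem_set.
Qed.

Lemma multiplier_submod : submod_closed [in multiplier_set].
Proof.
have X0 : Xset 0 by apply/set_mem; have [] := cmod_submod X.
split.
  apply: mem_set => x Xx; rewrite -(scale0r 0) adjZ conjC0 !scale0r.
  by rewrite bcomp0l.
move=> c b1 b2 /set_mem b1P /set_mem b2P; apply: mem_set => x Xx.
have [? ?] := b1P _ Xx; have [? ?] := b2P _ Xx.
by rewrite adjD adjZ !bcompDl !bcompZl; split; exact: XlinP.
Qed.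

Lemma multiplierM a b :
  multiplier_set a -> multiplier_set b -> multiplier_set (amul a b).
Proof.
move=> aP bP x Xx; rewrite /amul/= adjM -!bcompA; split.
  by apply: (aP _ _).1; exact: (bP _ Xx).1.
by apply: (bP _ _).2; exact: (aP _ Xx).2.
Qed.

Lemma multiplierJ a : multiplier_set a -> multiplier_set (astar a).
Proof. by move=> aP x /aP[]; rewrite /astar/= adjK. Qed.

Definition multiplier_alg : starSubalg (bop H1 H1) :=
  StarSubalg multiplier_submod multiplierM multiplierJ.

Definition left_mult (b : starsub_elt multiplier_alg) (x : cmod_elt) : cmod_elt :=
  cmod_elt_of (starsub_in b (val x) (cmod_in x)).1.

End HilbertModule.

Definition linear_span (R : realType) (V : lmodType R[i]) (S : set V) : set V :=
  [set v | exists n (c : 'I_n -> R[i]) (s : 'I_n -> V),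
     (forall i, S (s i)) /\ v = \sum_(i < n) c i *: s i].

(* X H0 = span {x xi : x in X, xi in H0}. *)
Definition module_range (R : realType) (H0 H1 : hilbertType R)
    (A : concrete_cstar H0) (X : hilbert_module H1 A) : set H1 :=
  linear_span [set v | exists (x : cmod_elt X) (xi : H0), v = cmod_val x xi].

(* Main.v *)
Require Import Defs.
From mathcomp Require Import all_boot all_order all_algebra.
From mathcomp Require Import boolp classical_sets reals topology normedtype.
From mathcomp Require Import complex sequences ring lra.

Set Implicit Arguments.
Unset Strict Implicit.
Unset Printing Implicit Defensive.
Import Order.TTheory GRing.Theory Num.Def Num.Theory.
Import numFieldNormedType.Exports.
Local Open Scope classical_set_scope.
Local Open Scope ring_scope.
Local Open Scope complex_scope.

(** The theorem says that an adjointable map of X is left multiplication by a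
    bounded operator of H1. Multiplication by b in B is adjointable, with adjoint
    multiplication by the adjoint of b, because (b x)^* y = x^* (b^* y); it
    determines b because X H0 is dense. This makes tau an injective
    *-homomorphism, and the content is its surjectivity.

    Let t be adjointable with adjoint s. The only candidate for b sends
    sum_i x_i xi_i to sum_i t(x_i) xi_i, and it must be shown to be well defined
    and bounded. The usual argument takes a positive square root in the
    C*-algebra of adjointable maps; here it is replaced by the following
    elementary one.

    Put h = s t, and p_k = sum_i h^k(x_i) xi_i. Since (t x)^* y = x^* (s y),
    adjointness passes to the inner product of H1 (adjop_hdot), so that
    <p_j, p_k> = <p_0, p_(j+k)>. By the Cauchy-Schwarz inequality
    |p_k|^2 <= |p_0| |p_(2k)|, and a sequence with this property that grows at
    most like C M^k satisfies |p_1| <= M |p_0| (doubling_growth); the constant C,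
    over which there is no control, disappears. Then
    |sum_i t(x_i) xi_i|^2 = <p_0, p_1> <= M |p_0|^2, uniformly in the x_i and
    xi_i (adjop_sum_bounded).

    The growth bound |h^k(x)| <= M^k |x| needs h to be bounded for the operator
    norm. This is a theorem of Hellinger-Toeplitz type, and it is where the
    closedness of X is used: for an unbounded adjointable map, a gliding hump
    would produce a point of X whose image under the adjoint map has norm larger
    than every integer (adjop_bounded).

    The candidate is then a bounded linear graph over a dense domain, which
    extends to a bounded operator b on H1 (dense_graph_extension,
    adjop_extends). Moreover b^* x = s(x) on X, since both sides have the same
    inner products with X H0 (adj_extension). Hence b lies in B and tau b = t. *)

(** * Real-valued norms and limits *)

Section RealNorm.
Context {R : realType}.
Implicit Types V : normedModType R[i].

(** The norms at hand take values in the partially ordered field R[i]; their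
    real parts live in a totally ordered field, where case analysis and linear
    arithmetic are available. *)
Definition rnorm V (v : V) : R := complex.Re `|v|.

Lemma rnormE V (v : V) : (rnorm v)%:C = `|v|.
Proof. by rewrite RRe_real ?normr_real. Qed.

Lemma rnorm_ge0 V (v : V) : 0 <= rnorm v.
Proof. by rewrite -ler0c rnormE. Qed.

Lemma rnorm0 V : rnorm (0 : V) = 0.
Proof. by rewrite /rnorm normr0. Qed.

Lemma rnorm_gt0 V (v : V) : v != 0 -> 0 < rnorm v.
Proof. by rewrite -ltcR rnormE normr_gt0. Qed.

Lemma rnormD V (v w : V) : rnorm (v + w) <= rnorm v + rnorm w.
Proof. by rewrite -lecR rmorphD /= !rnormE ler_normD. Qed.

Lemma rnormB V (v w : V) : rnorm (v - w) = rnorm (w - v).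
Proof. by rewrite /rnorm distrC. Qed.

Lemma rnormN V (v : V) : rnorm (- v) = rnorm v.
Proof. by rewrite /rnorm normrN. Qed.

Lemma rnorm_dist V (u v w : V) : rnorm (v - w) <= rnorm (v - u) + rnorm (u - w).
Proof. by rewrite (le_trans _ (rnormD _ _))// addrA subrK. Qed.

Lemma rnormZ V (c : R) (v : V) : rnorm (c%:C *: v) = `|c| * rnorm v.
Proof.
apply: complexI; rewrite rnormE normrZ rmorphM /= rnormE normc_def /=.
by rewrite expr0n addr0 sqrtr_sqr.
Qed.

Lemma rnormZC V (c : R[i]) (v : V) : rnorm (c *: v) = rnorm (c : R[i]^o) * rnorm v.
Proof. by apply: complexI; rewrite rnormE normrZ rmorphM /= !rnormE. Qed.

Lemma rnorm_sum V (I : Type) (r : seq I) (F : I -> V) :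
  rnorm (\sum_(i <- r) F i) <= \sum_(i <- r) rnorm (F i).
Proof.
elim/big_ind2 : _ => [|x a y b xa yb|//]; first by rewrite rnorm0.
by rewrite (le_trans (rnormD _ _))// lerD.
Qed.

Lemma closed_rnorm V (F : set V) v :
  closed F -> (forall e : R, 0 < e -> exists2 w, F w & rnorm (v - w) < e) -> F v.
Proof.
move=> Fcl Fv; apply: Fcl => B /nbhs_ballP[e /= e0 eB].
have eE : (complex.Re e)%:C = e by rewrite RRe_real// gtr0_real.
have [|w Fw vw] := Fv (complex.Re e); first by rewrite -ltcR eE.
exists w; split => //; apply: eB.
by rewrite -ball_normE /= -rnormE -eE ltcR.
Qed.

Lemma dense_rnorm V (F : set V) v (e : R) :
  dense F -> 0 < e -> exists2 w, F w & rnorm (v - w) < e.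
Proof.
move=> Fd e0.
have e0C : 0 < e%:C by rewrite ltcR.
have [||w [/= wv Fw]] := Fd (ball v e%:C).
- by exists v; exact: ballxx.
- exact: ball_open.
exists w => //.
by move: wv; rewrite -ball_normE /= -rnormE ltcR.
Qed.

Lemma cvg0_small (e : nat -> R) (d : R) :
  e @ \oo --> 0 -> 0 < d -> exists n, e n < d.
Proof.
move=> /cvgrPdist_lt/[apply] -[n _ /(_ n (leqnn n))/=].
by rewrite sub0r normrN => en; exists n; rewrite (le_lt_trans _ en)// ler_norm.
Qed.

(** Completeness in quantitative form: the Cauchy rate survives in the limit.
    The bound at index [n] is what lets a limit be compared with one chosen
    term of the sequence. *)
Lemma limit_with_rate (V : completeNormedModType R[i]) (u : nat -> V) (e : nat -> R) :
  e @ \oo --> 0 -> (forall n m, (n <= m)%N -> rnorm (u n - u m) <= e n) ->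
  exists l, forall n, rnorm (u n - l) <= e n.
Proof.
move=> e0 ue.
have dE (d : R[i]) : 0 < d -> (complex.Re d)%:C = d /\ 0 < complex.Re d.
  move=> d0; have E : (complex.Re d)%:C = d by rewrite RRe_real// gtr0_real.
  by split=> //; rewrite -ltcR E.
have ucauchy : cauchy (u @ \oo).
  apply: cauchy_exP => d /dE[dE1 /(cvg0_small e0)[N eN]].
  exists (u N), N => // n /= Nn.
  by rewrite -ball_normE /= -rnormE -dE1 ltcR (le_lt_trans (ue _ _ Nn)).
have [l ul] : exists l : V, u @ \oo --> l by apply/cvg_ex; exact: cauchy_cvg.
exists l => n; apply/ler_addgt0Pr => d d0.
have dC0 : 0 < d%:C by rewrite ltcR.
have /cvgrPdist_lt/(_ _ dC0)[N _ /(_ _ (leq_maxl N n))/=] := ul.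
rewrite -rnormE ltcR rnormB => lN.
rewrite (le_trans (rnorm_dist (u (maxn N n)) _ _))//.
by rewrite lerD ?(ltW lN)// ue// leq_maxr.
Qed.

(** If a_1 = q a_0 with q > M, then doubling gives a_n >= a_0 q^n for all powers
    n of 2, which outgrows C M^n. *)
Lemma doubling_growth (a : nat -> R) (C M : R) :
  0 < M -> (forall k, 0 <= a k) -> (forall k, a k ^+ 2 <= a 0 * a k.*2) ->
  (forall k, a k <= C * M ^+ k) -> a 1 <= M * a 0.
Proof.
move=> M0 a0 aa aM; rewrite leNgt; apply/negP => lt1.
have a00 : 0 < a 0.
  rewrite lt_def a0 andbT; apply/eqP => a00.
  have := aa 1; rewrite a00 mul0r; move: lt1; rewrite a00; nra.
(* The excess of a_1 / a_0 over M, relative to M. *)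
pose d := a 1 / a 0 / M - 1.
have d0 : 0 < d by rewrite subr_gt0 -mulrA -invfM ltr_pdivlMr ?mulr_gt0// mul1r mulrC.
have qE : a 1 / a 0 = M * (1 + d).
  by rewrite /d; field; rewrite !gt_eqF.
have d1 : 0 <= 1 + d by lra.
have lower k : a 0 * (a 1 / a 0) ^+ (2 ^ k) <= a (2 ^ k)%N.
  elim: k => [|k IH]; first by rewrite expn0 expr1 mulrC divfK// gt_eqF.
  rewrite expnS mul2n -(ler_pM2l a00) (le_trans _ (aa _))//.
  rewrite -muln2 exprM mulrA -expr2 -exprMn.
  by rewrite lerXn2r ?nnegrE ?mulr_ge0 ?exprn_ge0 ?divr_ge0.
(* Bernoulli's inequality. *)
have bern n : 1 + d *+ n <= (1 + d) ^+ n.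
  elim: n => [|n IH]; first by rewrite mulr0n addr0 expr0.
  rewrite exprS mulrSr (le_trans _ (ler_wpM2l _ IH)) //.
  have : 0 <= d *+ n by rewrite mulrn_wge0// ltW.
  nra.
have /archi_boundP : 0 <= `|C| / (a 0 * d) by rewrite divr_ge0// mulr_ge0 // ltW.
set k := Num.bound _; rewrite ltr_pdivrMr ?mulr_gt0// => Ck.
have := le_trans (lower k) (aM _).
rewrite qE exprMn mulrCA [leRHS]mulrC ler_pM2l ?exprn_gt0// => le1.
have le2 := le_trans (ler_wpM2l (ltW a00) (bern (2 ^ k)%N)) le1.
have : d *+ k <= d *+ (2 ^ k) by rewrite ler_pMn2l// ltnW// ltn_expl.
move: le2 Ck (ler_norm C); rewrite -[d *+ k]mulr_natr; move: (d *+ _) (k%:R) => p q.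
nra.
Qed.

End RealNorm.

(** * Bounded operators *)

Section Operators.
Context {R : realType}.
Implicit Types H K L : hilbertType R.

Lemma rnorm_bop H K (T : bop H K) x : rnorm (T x) <= rnorm T * rnorm x.
Proof. by rewrite -lecR rmorphM /= !rnormE; exact: opnorm_ub. Qed.

Lemma rnorm_bop_le H K (T : bop H K) (M : R) :
  0 <= M -> (forall x, rnorm (T x) <= M * rnorm x) -> rnorm T <= M.
Proof.
move=> M0 TM; rewrite -lecR rnormE; apply: opnorm_le; first by rewrite ler0c.
by move=> x; rewrite -!rnormE -rmorphM lecR.
Qed.

Lemma rnorm_bcomp H K L (S : bop K L) (T : bop H K) :
  rnorm (bcomp S T) <= rnorm S * rnorm T.
Proof.
apply: rnorm_bop_le => [|x]; first by rewrite mulr_ge0 ?rnorm_ge0.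
rewrite -mulrA (le_trans (rnorm_bop S (T x)))// ler_wpM2l ?rnorm_ge0//.
exact: rnorm_bop.
Qed.

Lemma rnorm_sqr H (x : H) : (rnorm x ^+ 2)%:C = hdot x x.
Proof. by rewrite -hnormE rmorphXn /= rnormE. Qed.

Lemma rnorm_hdot H (x y : H) : rnorm (hdot x y : R[i]^o) <= rnorm x * rnorm y.
Proof. by rewrite -lecR rmorphM /= !rnormE; exact: hdot_CauchySchwarz. Qed.

(** The form in which the Cauchy-Schwarz inequality is used: an adjunction
    rewrites the square of a norm as another inner product. *)
Lemma rnorm_sqr_hdot H K (x : H) (u v : K) :
  hdot x x = hdot u v -> rnorm x ^+ 2 <= rnorm u * rnorm v.
Proof.
move=> xuv; apply: le_trans (rnorm_hdot u v).
by rewrite -lecR rnormE rnorm_sqr -xuv ger0_norm// dnorm_ge0.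
Qed.

Lemma rnorm_adj H K (T : bop H K) : rnorm (adj T) = rnorm T.
Proof.
suff le L M (S : bop L M) : rnorm (adj S) <= rnorm S.
  by apply/eqP; rewrite eq_le le -{1}(adjK T) le.
apply: rnorm_bop_le => [|y]; first exact: rnorm_ge0.
have := rnorm_sqr_hdot (esym (adjP S (adj S y) y)).
move=> /le_trans /(_ (ler_wpM2r (rnorm_ge0 y) (rnorm_bop S (adj S y)))).
rewrite mulrAC; have := mulr_ge0 (rnorm_ge0 S) (rnorm_ge0 y); nra.
Qed.

(** The nontrivial half of the C*-identity, from
    |T x|^2 = <x, T^* T x> <= |x| |T^* T x|. *)
Lemma rnorm_adj_comp H K (T : bop H K) :
  rnorm T ^+ 2 <= rnorm (bcomp (adj T) T).
Proof.
have c0 := rnorm_ge0 (bcomp (adj T) T).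
suff : rnorm T <= Num.sqrt (rnorm (bcomp (adj T) T)).
  by rewrite -ler_sqr ?nnegrE ?rnorm_ge0 ?sqrtr_ge0// sqr_sqrtr.
apply: rnorm_bop_le => [|x]; first exact: sqrtr_ge0.
rewrite -ler_sqr ?nnegrE ?mulr_ge0 ?rnorm_ge0 ?sqrtr_ge0// exprMn sqr_sqrtr//.
rewrite (le_trans (rnorm_sqr_hdot (adjP T x (T x))))// expr2 mulrCA.
by rewrite ler_wpM2l ?rnorm_ge0//; exact: (rnorm_bop (bcomp (adj T) T)).
Qed.

(** The pointwise limit exists by completeness of [K], and inherits the rate,
    uniformly on the unit ball, because the rate at [x] is [e n] times the norm
    of [x]. *)
Lemma bop_limit_with_rate H K (u : nat -> bop H K) (e : nat -> R) :
  e @ \oo --> 0 -> (forall n m, (n <= m)%N -> rnorm (u n - u m) <= e n) ->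
  exists T, forall n, rnorm (u n - T) <= e n.
Proof.
move=> e0 ue.
have e_ge0 n : 0 <= e n by rewrite (le_trans _ (ue n n _))// rnorm_ge0.
have /choice[T TP] x : exists y, forall n, rnorm (u n x - y) <= e n * rnorm x.
  apply: limit_with_rate => [|n m nm].
    by rewrite -(mul0r (rnorm x)); apply: cvgM => //; exact: cvg_cst.
  rewrite (le_trans (rnorm_bop (u n - u m) x))//.
  by rewrite ler_wpM2r ?rnorm_ge0// ue.
have small (C : R) : 0 <= C -> forall d : R, 0 < d -> exists n, e n * C < d.
  move=> C0 d d0.
  apply: cvg0_small d0; rewrite -(mul0r C).
  by apply: cvgM => //; exact: cvg_cst.
have Tlin : linear T.
  move=> c x y; apply/eqP; rewrite -subr_eq0 -normr_le0 -rnormE lecR.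
  apply/ler_addgt0Pr => d d0; rewrite add0r.
  have [|n nd] := small (rnorm (c *: x + y) +
    (rnorm (c : R[i]^o) * rnorm x + rnorm y)) _ d d0.
    by rewrite !(addr_ge0, mulr_ge0) ?rnorm_ge0.
  apply: le_trans (ltW nd); apply: (le_trans (rnorm_dist (u n (c *: x + y)) _ _)).
  rewrite mulrDr lerD//; first by rewrite rnormB.
  rewrite linearP opprD addrACA -scalerBr (le_trans (rnormD _ _))// mulrDr.
  apply: lerD; last exact: TP.
  by rewrite rnormZC mulrCA ler_wpM2l ?rnorm_ge0//; exact: TP.
have Tb : T \in @bounded_linear R H K.
  apply/asboolP; split => //; exists (rnorm (u 0%N) + e 0%N) => x.
  rewrite -!rnormE -rmorphM lecR -[T x]subr0.
  rewrite (le_trans (rnorm_dist (u 0%N x) _ _))// mulrDl addrC lerD//.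
    by rewrite subr0 rnorm_bop.
  by rewrite rnormB.
exists (Bop Tb) => n; apply: rnorm_bop_le => // x; exact: TP.
Qed.

(** A densely defined bounded operator extends to the whole space. It is given by
    its graph [G] so that nothing has to be chosen to define it: the bound makes
    a linear relation single-valued. *)
Lemma dense_graph_extension H K (G : set (H * K)%type) (M : R) :
  (forall (c : R[i]) p q, G p -> G q -> G (c *: p + q)) ->
  (forall p, G p -> rnorm p.2 <= M * rnorm p.1) ->
  dense (fst @` G) ->
  exists b : bop H K, forall p, G p -> b p.1 = p.2.
Proof.
move=> Glin GM0 Gd.
wlog M0 : M GM0 / 0 < M.
  move=> /(_ (`|M| + 1)); apply; last by rewrite ltr_wpDl.
  move=> p /GM0 /le_trans; apply; rewrite ler_wpM2r ?rnorm_ge0//.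
  by rewrite (le_trans (ler_norm _))// lerDl.
have GM p q : G p -> G q -> rnorm (p.2 - q.2) <= M * rnorm (p.1 - q.1).
  move=> Gp Gq; have := GM0 _ (Glin (-1) _ _ Gq Gp).
  by rewrite /= !scaleN1r ![- _ + _]addrC.
have approx (x : H) (d : R) : 0 < d -> exists2 p, G p & rnorm (x - p.1) < d.
  by move=> d0; have [_ [p Gp <-] xp] := dense_rnorm x Gd d0; exists p.
(* This property determines [b x]: it holds for all of [G] at once, so it is
   independent of the sequence used to reach [x]. *)
have /choice[b bP] x : exists y, forall p, G p -> rnorm (y - p.2) <= M * rnorm (x - p.1).
  have e0 n : 0 < 2^-1 ^+ n :> R by rewrite exprn_gt0// invr_gt0.
  have /choice[u uP] n : exists p, G p /\ rnorm (x - p.1) < 2^-1 ^+ n.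
    by have [p] := approx x _ (e0 n); exists p.
  have eM0 C : (fun n => C * 2^-1 ^+ n) @ \oo --> (0 : R).
    by apply: cvg_geometric; rewrite ger0_norm ?invr_ge0//; lra.
  have [n m nm|y yP] := limit_with_rate (u := fun n => (u n).2) (eM0 (M * 2)).
    rewrite (le_trans (GM _ _ (uP _).1 (uP _).1))// -mulrA ler_wpM2l ?(ltW M0)//.
    rewrite (le_trans (rnorm_dist x _ _))// rnormB mulr2n mulrDl !mul1r lerD//.
      exact: (ltW (uP _).2).
    by rewrite (le_trans (ltW (uP _).2))// ler_wiXn2l//; lra.
  exists y => p Gp; apply/ler_addgt0Pr => d d0.
  have [n nd] := cvg0_small (eM0 (M * 3)) d0.
  have up : rnorm ((u n).1 - p.1) <= 2^-1 ^+ n + rnorm (x - p.1).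
    rewrite (le_trans (rnorm_dist x _ _))// lerD// rnormB.
    exact: (ltW (uP n).2).
  have := le_trans (GM _ _ (uP n).1 Gp) (ler_wpM2l (ltW M0) up).
  have := rnorm_dist (u n).2 y p.2; rewrite [rnorm (y - (u n).2)]rnormB.
  have /= := yP n; lra.
have blin : linear b.
  move=> c x y; apply/eqP; rewrite -subr_eq0 -normr_le0 -rnormE lecR.
  apply/ler_addgt0Pr => d d0; rewrite add0r.
  pose C := rnorm (c : R[i]^o).
  have C0 : 0 <= C by exact: rnorm_ge0.
  (* The failure of linearity is bounded twice, through [bP] at [c *: x + y] and
     at [x] and [y], by [M] times the distances to a point of [G]. *)
  have d'0 : 0 < d / (2 * M * (C + 1)) by rewrite divr_gt0// !mulr_gt0// ltr_wpDl.
  have [p Gp xp] := approx x _ d'0; have [q Gq yq] := approx y _ d'0.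
  have E (V : normedModType R[i]) (v1 v2 w1 w2 : V) :
      rnorm (c *: v1 + v2 - (c *: w1 + w2)) <= C * rnorm (v1 - w1) + rnorm (v2 - w2).
    by rewrite opprD addrACA -scalerBr (le_trans (rnormD _ _))// rnormZC.
  pose r := C * rnorm (x - p.1) + rnorm (y - q.1).
  have rd : 2 * M * r <= d.
    rewrite mulrC -ler_pdivlMr ?mulr_gt0//.
    rewrite (le_trans (lerD (ler_wpM2l C0 (ltW xp)) (ltW yq)))//.
    rewrite le_eqVlt; apply/orP; left; apply/eqP; field.
    by rewrite !gt_eqF// ltr_wpDl.
  apply: le_trans rd; apply: (le_trans (rnorm_dist (c *: p.2 + q.2) _ _)).
  rewrite -mulrA mulr2n mulrDl mul1r; apply: lerD.
    rewrite (le_trans (bP _ _ (Glin c _ _ Gp Gq)))// ler_wpM2l ?(ltW M0)//.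
    exact: E.
  rewrite rnormB (le_trans (E _ _ _ _ _))// mulrDr mulrCA lerD//; last exact: bP.
  by rewrite ler_wpM2l// bP.
have Gb p : G p -> b p.1 = p.2.
  move=> Gp; apply/eqP; rewrite -subr_eq0 -normr_le0 -rnormE lecR.
  by rewrite (le_trans (bP _ _ Gp))// subrr rnorm0 mulr0.
suff bB : b \in @bounded_linear R H K by exists (Bop bB).
apply/asboolP; split => //; exists M => x.
rewrite -!rnormE -rmorphM lecR -[b x]subr0 -[x in leRHS]subr0.
have [p Gp _] := approx x _ ltr01.
apply: (bP x (0, 0)); rewrite -[(0,0)](addNr p) -scaleN1r; exact: Glin.
Qed.

Lemma linear_span_linear (V : lmodType R[i]) (S : set V) (k : R[i]) (p q : V) :
  linear_span S p -> linear_span S q -> linear_span S (k *: p + q).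
Proof.
move=> [n [c [u [Su ->]]]] [m [d [v [Sv ->]]]].
exists (n + m)%N.
exists (fun i => match split i with inl i => k * c i | inr j => d j end).
exists (fun i => match split i with inl i => u i | inr j => v j end).
split=> [i|]; first by case: (split i).
rewrite big_split_ord /= scaler_sumr; congr (_ + _); apply: eq_bigr => i _.
  by rewrite (unsplitK (inl i)) scalerA.
by rewrite (unsplitK (inr i)).
Qed.

Lemma dense_span_hdot_eq0 H (S : set H) z :
  dense (linear_span S) -> (forall v, S v -> hdot v z = 0) -> z = 0.
Proof.
move=> Sd Sz; apply/eqP; rewrite -normr_le0 -rnormE lecR.
apply/ler_addgt0Pr => d d0; rewrite add0r.
have [_ [n [c [s [Ss ->]]]]] := dense_rnorm z Sd d0.
set w := \sum_(i < n) _ => zw.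
have wz : hdot w z = 0.
  by rewrite linear_sumlz big1// => i _; rewrite [LHS]hdotZl Sz// mulr0.
have : hdot z z = hdot (z - w) z by rewrite linearBl /= wz subr0.
move=> /rnorm_sqr_hdot; have := rnorm_ge0 z; nra.
Qed.

End Operators.

(** * Adjointable maps of a Hilbert module of operators *)

Section HilbertModules.
Context {R : realType} {H0 H1 : hilbertType R} {A : concrete_cstar H0}.
Context {X : hilbert_module H1 A}.
Implicit Types (t : adjointable_op X) (x y : cmod_elt X) (xi eta : H0).

Lemma bcomp_adj_adjop t x y :
  bcomp (adj (cmod_val (t x))) (cmod_val y) =
  bcomp (adj (cmod_val x)) (cmod_val (astar t y)).
Proof. exact: (congr1 val (adjop_adjP t x y)). Qed.

(** An adjoint for the A-valued inner product is an adjoint for the scalar inner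
    product of H1, since <x xi, y eta> = <xi, (x^* y) eta>. *)
Lemma adjop_hdot t x y xi eta :
  hdot (cmod_val (t x) xi) (cmod_val y eta) =
  hdot (cmod_val x xi) (cmod_val (astar t y) eta).
Proof.
rewrite !adjP.
exact: (congr1 (fun T : bop H0 H0 => hdot xi (T eta)) (bcomp_adj_adjop t x y)).
Qed.

(** The map [x |-> w^* x] is large at one of the two points [x + c w] and
    [x - c w], whatever [x] is: its values there differ by [2 c w^* w], of norm
    [2 c |w|^2]. The constant [c = e / |w|] makes the displacement have norm
    [e]. *)
Lemma gliding_hump_step (x w : bop H0 H1) (e : R) : 0 <= e ->
  exists c : R, rnorm (c%:C *: w) <= e /\
    e * rnorm w <= rnorm (bcomp (adj w) (x + c%:C *: w)).
Proof.
move=> e0; have [->|w0] := eqVneq w 0.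
  by exists 0; rewrite scaler0 rnorm0 mulr0; split => //; exact: rnorm_ge0.
have w_gt0 := rnorm_gt0 w0; pose c := e / rnorm w.
have c_ge0 : 0 <= c by rewrite divr_ge0// ltW.
have cw : c * rnorm w = e by rewrite divfK// gt_eqF.
have cwn b : `|b| = 1 -> rnorm ((b * c)%:C *: w) <= e.
  by move=> b1; rewrite rnormZ normrM b1 mul1r ger0_norm// cw.
have : e * rnorm w *+ 2 <= rnorm (bcomp (adj w) (x + (1 * c)%:C *: w)) +
    rnorm (bcomp (adj w) (x + (- 1 * c)%:C *: w)).
  rewrite -[X in _ <= _ + X]rnormN; apply: le_trans (rnormD _ _).
  have -> : bcomp (adj w) (x + (1 * c)%:C *: w) -
      bcomp (adj w) (x + (- 1 * c)%:C *: w) = (c *+ 2)%:C *: bcomp (adj w) w.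
    rewrite !bcompDr !bcompZr opprD addrACA subrr add0r -scalerBl.
    by rewrite -rmorphB; congr (_%:C *: _); ring.
  rewrite rnormZ ger0_norm ?mulrn_wge0// -cw mulrnAl -mulrA -expr2.
  rewrite lerMn2r /=; apply: ler_wpM2l => //; exact: rnorm_adj_comp.
have half (r a b : R) : r *+ 2 <= a + b -> r <= a \/ r <= b.
  by move=> rab; case: (leP r a) => [|ar]; [left|right; lra].
by move=> /half[]; [exists (1 * c)|exists (- 1 * c)]; rewrite cwn ?normr1 ?normrN1.
Qed.

(** A uniform boundedness argument. The maps [x |-> (t y)^* x = y^* s(x)], with
    [s] the adjoint of [t], are bounded at each [x] by [|y| |s x|]. If [t] is
    unbounded, choose [y n] with [|t (y n)|] above [n 3^n |y n|] and move a point
    of the module by at most [3^-n] at stage [n], so that [(t (y n))^*] becomes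
    large there. Later displacements add up to at most half of [3^-n], hence do
    not undo this, and the limit [z] violates the bound by [|s z|]. *)
Lemma adjop_bounded t :
  exists2 M : R, 0 < M & forall x, rnorm (cmod_val (t x)) <= M * rnorm (cmod_val x).
Proof.
have absurd (p q : R) : q <= p + 2^-1 * q -> 2 * p < q -> False by lra.
apply: contrapT => unb.
have /choice[y yP] n : exists y,
    (n%:R * 3 ^+ n) * rnorm (cmod_val y) < rnorm (cmod_val (t y)).
  apply: contrapT => ny; apply: unb; exists (n%:R * 3 ^+ n + 1).
    by rewrite ltr_wpDl// mulr_ge0// exprn_ge0.
  move=> x; rewrite leNgt; apply/negP => lt_tx; apply: ny; exists x.
  by apply: le_lt_trans lt_tx; rewrite ler_wpM2r ?rnorm_ge0// lerDl.
pose w n := t (y n).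
have e0 n : 0 < 3^-1 ^+ n :> R by rewrite exprn_gt0// invr_gt0.
have /choice[f fP] (nx : nat * cmod_elt X) : exists x',
    rnorm (cmod_val nx.2 - cmod_val x') <= 3^-1 ^+ nx.1 /\
    3^-1 ^+ nx.1 * rnorm (cmod_val (w nx.1)) <=
      rnorm (bcomp (adj (cmod_val (w nx.1))) (cmod_val x')).
  have [c [c1 c2]] :=
    gliding_hump_step (cmod_val nx.2) (cmod_val (w nx.1)) (ltW (e0 nx.1)).
  exists (nx.2 + c%:C *: w nx.1); split => //.
  by rewrite rnormB [_ + c%:C *: w _]addrC addrK.
pose v n := iteri n (fun k x => f (k, x)) 0.
have vstep n : rnorm (cmod_val (v n) - cmod_val (v n.+1)) <= 3^-1 ^+ n.
  by have [] := fP (n, v n).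
have vbig n : 3^-1 ^+ n * rnorm (cmod_val (w n)) <=
    rnorm (bcomp (adj (cmod_val (w n))) (cmod_val (v n.+1))).
  by have [] := fP (n, v n).
have vrate n m : (n <= m)%N ->
    rnorm (cmod_val (v n) - cmod_val (v m)) <= 3 / 2 * 3^-1 ^+ n.
  (* The geometric sum [3^-n + ... + 3^-(m-1)]. *)
  move=> nm; suff : rnorm (cmod_val (v n) - cmod_val (v m)) <=
      3 / 2 * (3^-1 ^+ n - 3^-1 ^+ m) by have := e0 m; lra.
  rewrite -(subnKC nm); elim: (m - n)%N => [|k IH].
    by rewrite addn0 !subrr rnorm0 mulr0.
  rewrite addnS (le_trans (rnorm_dist (cmod_val (v (n + k)%N)) _ _))//.
  have := vstep (n + k)%N; rewrite exprS; lra.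
have e_cvg : (fun n => 3 / 2 * 3^-1 ^+ n : R) @ \oo --> 0.
  by apply: cvg_geometric; rewrite ger0_norm ?invr_ge0//; lra.
have [z zP] := bop_limit_with_rate e_cvg vrate.
have Xz : (X : set (bop H0 H1)) z.
  apply: closed_rnorm; first exact: cmod_closed.
  move=> d /(cvg0_small e_cvg)[n nd].
  by exists (cmod_val (v n)); [exact: cmod_in|rewrite rnormB (le_lt_trans (zP n))].
pose B := rnorm (cmod_val (astar t (cmod_elt_of Xz))).
have wB n : rnorm (bcomp (adj (cmod_val (w n))) z) <= rnorm (cmod_val (y n)) * B.
  rewrite -[z]/(cmod_val (cmod_elt_of Xz)) bcomp_adj_adjop.
  by rewrite (le_trans (rnorm_bcomp _ _))// rnorm_adj.
have /archi_boundP : 0 <= 2 * B by rewrite mulr_ge0 ?rnorm_ge0.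
set n := Num.bound _ => nB.
(* The factor is [3 / 2 * 3^-(n+1)], the rate of convergence at stage [n + 1]. *)
have wv : rnorm (bcomp (adj (cmod_val (w n))) (cmod_val (v n.+1))) <=
    rnorm (cmod_val (y n)) * B + 2^-1 * (3^-1 ^+ n * rnorm (cmod_val (w n))).
  rewrite -[cmod_val (v n.+1)](subrK z) bcompDr addrC (le_trans (rnormD _ _))//.
  rewrite lerD// mulrA [leRHS]mulrC (le_trans (rnorm_bcomp _ _))// rnorm_adj.
  rewrite ler_wpM2l ?rnorm_ge0//.
  rewrite (le_trans (zP n.+1))// exprS mulrA ler_wpM2r ?(ltW (e0 n))//.
  by rewrite ler_pdivrMr//; lra.
have lt_n : n%:R * rnorm (cmod_val (y n)) < 3^-1 ^+ n * rnorm (cmod_val (w n)).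
  by rewrite exprVn [ltRHS]mulrC ltr_pdivlMr ?exprn_gt0// mulrAC.
have := le_lt_trans (ler_wpM2l (rnorm_ge0 (cmod_val (y n))) (ltW nB)).
rewrite mulrC => /(_ _ lt_n).
rewrite mulrCA; exact: (absurd _ _ (le_trans (vbig n) wv)).
Qed.

(** Iterating the Cauchy-Schwarz inequality turns a bound for [h = t^* t] on the
    module into the same bound for [h] acting on the sums of vectors [x xi],
    independently of the number of terms. *)
Lemma adjop_sum_bounded t : exists M : R,
  forall n (c : 'I_n -> R[i]) (x : 'I_n -> cmod_elt X) (xi : 'I_n -> H0),
    rnorm (\sum_i c i *: cmod_val (t (x i)) (xi i)) <=
    M * rnorm (\sum_i c i *: cmod_val (x i) (xi i)).
Proof.
pose h : adjointable_op X := amul (astar t) t.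
have [M M0 hM] := adjop_bounded h.
(* [M + 1] is a convenient upper bound for the square root of [M]. *)
exists (M + 1) => n c x xi.
pose v (s : cmod_elt X -> cmod_elt X) := \sum_i c i *: cmod_val (s (x i)) (xi i).
have v_adj (r : adjointable_op X) s u :
    hdot (v (r \o s)) (v u) = hdot (v s) (v ((astar r : adjointable_op X) \o u)).
  rewrite !linear_sumlz; apply: eq_bigr => i _; rewrite !linear_sumr.
  apply: eq_bigr => j _; rewrite [LHS]hdotZl [RHS]hdotZl; congr (_ * _).
  by rewrite [LHS]hdotZr [RHS]hdotZr adjop_hdot.
pose p k := v (iter k h).
have hJ : astar h = h by rewrite /h astarM astarK.
have pE j k : hdot (p j) (p k) = hdot (p 0) (p (j + k)%N).
  elim: j k => // j IH k; rewrite addSnnS -IH.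
  by have := v_adj h (iter j h) (iter k h); rewrite hJ.
(* The triangle inequality loses a constant that depends on the whole sum, but
   keeps the growth rate in [k]. *)
have rate k : rnorm (p k) <=
    (\sum_i rnorm (c i : R[i]^o) * (rnorm (cmod_val (x i)) * rnorm (xi i))) * M ^+ k.
  rewrite (le_trans (rnorm_sum _ _))// mulr_suml ler_sum// => i _.
  rewrite rnormZC -mulrA ler_wpM2l ?rnorm_ge0//.
  rewrite (le_trans (rnorm_bop _ _))// mulrAC ler_wpM2r ?rnorm_ge0//.
  elim: k => [|k IH]; first by rewrite expr0 mulr1.
  by rewrite exprS mulrCA (le_trans (hM _))// ler_wpM2l ?(ltW M0).
have p1 : rnorm (p 1) <= M * rnorm (p 0).
  apply: (doubling_growth M0 _ _ rate) => k; first exact: rnorm_ge0.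
  by apply: rnorm_sqr_hdot; rewrite pE addnn.
have vt : rnorm (v t) ^+ 2 <= rnorm (p 0) * rnorm (p 1).
  by apply: rnorm_sqr_hdot; exact: (v_adj t id t).
have p0 := rnorm_ge0 (p 0).
rewrite -ler_sqr ?nnegrE ?rnorm_ge0 ?mulr_ge0 ?addr_ge0 ?(ltW M0)//.
apply: (le_trans vt); rewrite (le_trans (ler_wpM2l p0 p1))//.
rewrite -/(p 0); move: (rnorm (p 0)) p0 => a; nra.
Qed.

Context (dense_range : dense (module_range X)).

(** Passing to adjoints turns agreement on the dense set X H0 into orthogonality
    to it. *)
Lemma bop_eq_on_module K (b b' : bop H1 K) :
  (forall x xi, b (cmod_val x xi) = b' (cmod_val x xi)) -> b = b'.
Proof.
move=> bb'; apply/eqP; rewrite -subr_eq0 -[b - b']adjK; apply/eqP.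
suff -> : adj (b - b') = 0 by apply: adj_uniq => u v; rewrite bop0E !(linear0l, linear0r).
apply: bopP => u; apply: (dense_span_hdot_eq0 dense_range) => _ [x [xi ->]].
by rewrite -adjP bopDE bb' subrr linear0l.
Qed.

(** The graph of the candidate is the span of the pairs [(x xi, t(x) xi)]; its
    bound is that of the sums, and its domain is X H0. *)
Lemma adjop_extends t :
  exists b : bop H1 H1, forall x, bcomp b (cmod_val x) = cmod_val (t x).
Proof.
have [M tM] := adjop_sum_bounded t.
pose S := [set p : H1 * H1 | exists x xi, p = (cmod_val x xi, cmod_val (t x) xi)].
have fst_sum n (c : 'I_n -> R[i]) (s : 'I_n -> H1 * H1) :
    (\sum_i c i *: s i).1 = \sum_i c i *: (s i).1.
  exact: (big_morph fst (fun p q => erefl) erefl).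
have snd_sum n (c : 'I_n -> R[i]) (s : 'I_n -> H1 * H1) :
    (\sum_i c i *: s i).2 = \sum_i c i *: (s i).2.
  exact: (big_morph snd (fun p q => erefl) erefl).
have [|_ [n [c [s [Ss ->]]]]||b bG] := @dense_graph_extension _ _ _ (linear_span S) M.
- exact: linear_span_linear.
- rewrite fst_sum snd_sum.
  have /choice[xxi xxiE] i : exists q : cmod_elt X * H0,
      s i = (cmod_val q.1 q.2, cmod_val (t q.1) q.2).
    by have [x [xi sE]] := Ss i; exists (x, xi).
  under eq_bigr do rewrite xxiE.
  under [X in _ * rnorm X]eq_bigr do rewrite xxiE.
  exact: tM.
- move=> U U0 Uo; have [w [Uw [n [c [s [Ss wE]]]]]] := dense_range U0 Uo.
  exists w.
  have /choice[xxi xxiE] i : exists q : cmod_elt X * H0, s i = cmod_val q.1 q.2.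
    by have [x [xi sE]] := Ss i; exists (x, xi).
  split=> //; pose s' i := (s i, cmod_val (t (xxi i).1) (xxi i).2).
  exists (\sum_i c i *: s' i); last by rewrite wE fst_sum.
  by exists n, c, s'; split=> // i; exists (xxi i).1, (xxi i).2; rewrite /s' xxiE.
- exists b => x; apply: bopP => xi.
  apply: (bG (cmod_val x xi, cmod_val (t x) xi)).
  exists 1%N, (fun=> 1), (fun=> (cmod_val x xi, cmod_val (t x) xi)).
  by split; [move=> _; exists x, xi|rewrite big_ord1 scale1r].
Qed.

(** The vector [(b^* y) eta] is determined by its inner products with the dense
    set X H0, and on that set the adjoint of [b] can be traded for that of [t]. *)
Lemma adj_extension t (b : bop H1 H1) :
  (forall x, bcomp b (cmod_val x) = cmod_val (t x)) ->
  forall x, bcomp (adj b) (cmod_val x) = cmod_val (astar t x).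
Proof.
move=> bt y; apply: bopP => eta; apply/eqP; rewrite -subr_eq0; apply/eqP.
apply: (dense_span_hdot_eq0 dense_range) => _ [x [xi ->]].
rewrite linearBr /= -adjP -adjop_hdot -bt /=; exact: subrr.
Qed.

Lemma left_mult_adjointable (b : starsub_elt (multiplier_alg X)) :
  left_mult b \in @adjointable _ _ _ _ X.
Proof.
apply/asboolP; exists (left_mult (astar b)) => x y; apply: val_inj => /=.
by rewrite adjM bcompA.
Qed.

End HilbertModules.

(** * The multiplier algebra and the adjointable maps *)

Theorem proposition2p8 (R : realType) (H0 H1 : hilbertType R)
    (A : concrete_cstar H0) (X : hilbert_module H1 A)
    (hX : dense (module_range X)) :
  exists tau : starsub_elt (multiplier_alg X) -> adjointable_op X,
    (forall (b : starsub_elt (multiplier_alg X)) (x : cmod_elt X),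
       tau b x = left_mult b x) /\
    star_isomorphism tau.
Proof.
pose tau b := AdjointableOp (@left_mult_adjointable _ _ _ _ X b).
exists tau; split=> //.
have tau_inj : injective tau.
  move=> b b' bb'; apply/val_inj/(bop_eq_on_module hX) => x xi.
  have := congr1 (fun t : adjointable_op X => cmod_val (t x) xi) bb'.
  exact.
have /choice[sigma sigmaP] t : exists b, tau b = t.
  have [b bt] := adjop_extends hX t.
  have bB : multiplier_set X b.
    move=> x Xx; rewrite -[x]/(cmod_val (cmod_elt_of Xx)).
    by rewrite bt (adj_extension hX bt); split; exact: cmod_in.
  exists (@starsub_elt_of _ _ (multiplier_alg X) b bB).
  by apply: adjopP => x; apply: val_inj; exact: bt.
split.
- by exists sigma => [b|//]; apply: tau_inj; rewrite sigmaP.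
- by move=> c b b'; apply: adjopP => x; apply: val_inj; rewrite /= bcompDl bcompZl.
- by move=> b b'; apply: adjopP => x; apply: val_inj; rewrite /= bcompA.
- move=> b; apply/esym/adjop_uniq => x y; apply: val_inj => /=.
  by rewrite adjM bcompA.
Qed.
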